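(* Let $n\ge1$. The classes of the monomials $l^\sigma$, $\sigma\in S_{n+1}$, form a basis (over $\mathbb Z$) of the homology module $G/U=H_*(X(A_n),\mathbb Z)$. The module of relations $U$ is generated (as a $\mathbb Z$-module) by the elements $r_{i,j}((A^{(h)})_h,k)$ for collections $A^{(1)}\subsetneq\dots\subsetneq A^{(m)}$ of elements of $\mathcal A$ and $k\in\{1,\dots,m+1\}$, $i,j\in A^{(k)}\setminus A^{(k-1)}$ (where $A^{(0)}=\emptyset$, $A^{(m+1)}=\{1,\dots,n+1\}$), $i\neq j$.
   Context: $X(A_n)$ is the smooth projective toric variety (here over $\mathbb C$) of the fan of Weyl chambers of the root system $A_n$. Concretely, $N(A_n)$ is generated by $v_1,\dots,v_{n+1}$ with the single relation $\sum_iv_i=0$. Let $\mathcal A=\{A:\emptyset\ne A\subsetneq\{1,\dots,n+1\}\}$ and $v_A=\sum_{i\in A}v_i$. The rays of the fan are generated by the $v_A$, $A\in\mathcal A$, and a set of $v_A$'s generates a cone of the fan iff the corresponding sets form a chain under inclusion. One has $H^*(X(A_n),\mathbb Z)\cong\mathbb Z[l_A;A\in\mathcal A]/(R_1+R_2)$, where $l_A$ corresponds to the torus invariant prime divisor of $v_A$, $R_1$ is the ideal generated by $\sum_{A\in\mathcal A,\,i\in A}l_A-\sum_{A\in\mathcal A,\,j\in A}l_A$ for $i\ne j$ in $\{1,\dots,n+1\}$, and $R_2$ is the ideal generated by $l_Al_{A'}$ for $A,A'\in\mathcal A$ with $A\not\subseteq A'$, $A'\not\subseteq A$. $G$ is the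 $\mathbb Z$-submodule of $\mathbb Z[l_A;A\in\mathcal A]$ generated by the monomials $\prod_{h=1}^m l_{A^{(h)}}$ for collections $A^{(1)}\subsetneq\dots\subsetneq A^{(m)}$ of elements of $\mathcal A$ ($m\ge0$, including the monomial $1$), and $U=(R_1+R_2)\cap G$. There is a canonical isomorphism of $\mathbb Z$-modules $G/U\cong\mathbb Z[l_A;A\in\mathcal A]/(R_1+R_2)$, and $G/U$ is identified with $H_*(X(A_n),\mathbb Z)$ (the monomial of a chain corresponds to the class of the torus orbit closure of the corresponding cone). For a collection $A^{(1)}\subsetneq\dots\subsetneq A^{(m)}$ of elements of $\mathcal A$ (with $A^{(0)}=\emptyset$, $A^{(m+1)}=\{1,\dots,n+1\}$), $k\in\{1,\dots,m+1\}$ and $i\ne j$ in $A^{(k)}\setminus A^{(k-1)}$, $$r_{i,j}((A^{(h)})_h,k)=\Big(\sum_{i\in A,\,j\notin A}l_A-\sum_{j\in A,\,i\notin A}l_A\Big)\prod_{h=1}^m l_{A^{(h)}},$$ where the sums run over sets $A\in\mathcal A$ with $A^{(k-1)}\subsetneq A\subsetneq A^{(k)}$. For $\sigma\in S_{n+1}$ let $\mathrm{Desc}(\sigma)=\{k\in\{1,\dots,n\}:\sigma(k)>\sigma(k+1)\}$ and $l^\sigma=\prod_{k\in\{1,\dots,n\}\setminus\mathrm{Desc}(\sigma)}l_{\{\sigma(1),\dots,\sigma(k)\}}\in G$. *)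

(* Defs.v *)
(* [boolp] is used so that spans and ideals, defined by an existential, are
   boolean predicates as the quotient construction requires. *)
From HB Require Import structures.
From mathcomp Require Import all_boot all_order all_fingroup all_algebra.
From mathcomp Require Import boolp.
From mathcomp Require Import mpoly.

Set Implicit Arguments.
Unset Strict Implicit.
Unset Printing Implicit Defensive.

Import GRing.Theory.
Local Open Scope ring_scope.

Definition zspan (M : zmodType) (S : M -> Prop) : {pred M} :=
  fun x => `[< exists s : seq (int * M),
    (forall u, u \in s -> S u.2) /\ x = \sum_(u <- s) u.2 *~ u.1 >].

Lemma zspan_zmod_closed (M : zmodType) (S : M -> Prop) : zmod_closed (zspan S).
Proof.
split; first by apply/asboolP; exists [::]; rewrite big_nil.
move=> x y /asboolP[s [hs ->]] /asboolP[t [ht ->]]; apply/asboolP.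
exists (s ++ [seq (- u.1, u.2) | u <- t]); split.
  move=> u; rewrite mem_cat => /orP[/hs//|/mapP[v vt ->]] /=; exact: ht.
rewrite big_cat /= big_map /= -sumrN; congr (_ + _).
by apply: eq_bigr => u _; rewrite mulrNz.
Qed.

HB.instance Definition _ (M : zmodType) (S : M -> Prop) :=
  GRing.isZmodClosed.Build M (zspan S) (zspan_zmod_closed S).

Definition ideal_gen (R : comNzRingType) (S : R -> Prop) : {pred R} :=
  fun x => `[< exists s : seq (R * R),
    (forall u, u \in s -> S u.2) /\ x = \sum_(u <- s) u.1 * u.2 >].

Lemma ideal_gen_zmod_closed (R : comNzRingType) (S : R -> Prop) :
  zmod_closed (ideal_gen S).
Proof.
split; first by apply/asboolP; exists [::]; rewrite big_nil.
move=> x y /asboolP[s [hs ->]] /asboolP[t [ht ->]]; apply/asboolP.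
exists (s ++ [seq (- u.1, u.2) | u <- t]); split.
  move=> u; rewrite mem_cat => /orP[/hs//|/mapP[v vt ->]] /=; exact: ht.
rewrite big_cat /= big_map /= -sumrN; congr (_ + _).
by apply: eq_bigr => u _; rewrite mulNr.
Qed.

HB.instance Definition _ (R : comNzRingType) (S : R -> Prop) :=
  GRing.isZmodClosed.Build R (ideal_gen S) (ideal_gen_zmod_closed S).

Definition add_pred (M : zmodType) (I J : {pred M}) : {pred M} :=
  fun x => `[< exists a b, [/\ a \in I, b \in J & x = a + b] >].

Definition is_Zbasis (M : zmodType) (I : finType) (b : I -> M) : Prop :=
  (forall x, exists c : I -> int, x = \sum_i b i *~ c i) /\
  (forall c : I -> int, \sum_i b i *~ c i = 0 -> forall i, c i = 0).

(* The ground set {1, ..., n+1} is ['I_n.+1], shifted to start at 0. *)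
Record properSubset (n : nat) := ProperSubset {
  pset : {set 'I_n.+1};
  psetP : (pset != set0) && (pset != setT) }.

HB.instance Definition _ (n : nat) := [isSub for @pset n].
HB.instance Definition _ (n : nat) := [Finite of properSubset n by <:].

Notation polyA n := {mpoly int[#|{: properSubset n}|]}.

Definition l (n : nat) (A : properSubset n) : polyA n := 'X_(enum_rank A).

Definition R1_gen (n : nat) (p : polyA n) : Prop :=
  exists i j : 'I_n.+1, i != j /\
    p = \sum_(A : properSubset n | i \in pset A) l A
        - \sum_(A : properSubset n | j \in pset A) l A.
Arguments R1_gen n _ : clear implicits.

Definition R2_gen (n : nat) (p : polyA n) : Prop :=
  exists A B : properSubset n,
    [/\ ~~ (pset A \subset pset B), ~~ (pset B \subset pset A) & p = l A * l B].
Arguments R2_gen n _ : clear implicits.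

Definition R12 (n : nat) : {pred polyA n} :=
  add_pred (ideal_gen (R1_gen n)) (ideal_gen (R2_gen n)).
Arguments R12 n _ : clear implicits.

Lemma R12_zmod_closed (n : nat) : zmod_closed (R12 n).
Proof.
split; first by apply/asboolP; exists 0, 0; rewrite !rpred0 addr0.
move=> x y /asboolP[a [b [ha hb ->]]] /asboolP[c [d [hc hd ->]]].
by apply/asboolP; exists (a - c), (b - d); rewrite !rpredB // opprD addrACA.
Qed.

HB.instance Definition _ (n : nat) :=
  GRing.isZmodClosed.Build (polyA n) (R12 n) (R12_zmod_closed n).

(* A chain A^(1) < ... < A^(m) is the sequence of its members, m >= 0. *)
Definition is_chain (n : nat) (s : seq (properSubset n)) : bool :=
  sorted (fun A B => pset A \proper pset B) s.

Definition chain_monomial (n : nat) (s : seq (properSubset n)) : polyA n :=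
  \prod_(A <- s) l A.

Definition G_gen (n : nat) (p : polyA n) : Prop :=
  exists s : seq (properSubset n), is_chain s /\ p = chain_monomial s.
Arguments G_gen n _ : clear implicits.

Definition G (n : nat) : {pred polyA n} := zspan (G_gen n).
Arguments G n _ : clear implicits.

HB.instance Definition _ (n : nat) := GRing.ZmodClosed.on (G n).

Definition U (n : nat) : {pred polyA n} :=
  fun p => (p \in R12 n) && (p \in G n).
Arguments U n _ : clear implicits.

(* G as a Z-module of its own, so that G/U can be formed as a quotient type. *)
Record Gmod (n : nat) := GmodOf { Gval : polyA n; Gval_in : Gval \in G n }.

HB.instance Definition _ (n : nat) := [isSub for @Gval n].
HB.instance Definition _ (n : nat) := [Choice of Gmod n by <:].
HB.instance Definition _ (n : nat) := [SubChoice_isSubZmodule of Gmod n by <:].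

Definition U_in_G (n : nat) : {pred Gmod n} := fun g => Gval g \in U n.
Arguments U_in_G n _ : clear implicits.

Lemma U_in_G_zmod_closed (n : nat) : zmod_closed (U_in_G n).
Proof.
have UE x : (x \in U_in_G n) = (Gval x \in R12 n).
  by apply/andP/idP => [[]|] // hx; split=> //; exact: Gval_in.
split=> [|x y]; rewrite !UE; first exact: rpred0.
have -> : Gval (x - y) = Gval x - Gval y by exact: (raddfB val).
exact: rpredB.
Qed.

HB.instance Definition _ (n : nat) :=
  GRing.isZmodClosed.Build (Gmod n) (U_in_G n) (@U_in_G_zmod_closed n).

Definition U_zmodClosed (n : nat) : zmodClosed (Gmod n) := U_in_G n.

(* G/U, identified with H_*(X(A_n), Z). *)
Definition homology (n : nat) : zmodType := Quotient.quot (U_zmodClosed n).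

Definition homology_class (n : nat) (g : Gmod n) : homology n :=
  \pi_(Quotient.quot (U_zmodClosed n))%qT g.

(* A^(0) = set0, A^(1), ..., A^(m), A^(m+1) = setT; the default value of [nth]
   supplies A^(m+1). *)
Definition chain_nth (n : nat) (s : seq (properSubset n)) (k : nat) :
    {set 'I_n.+1} :=
  nth setT (set0 :: map (@pset n) s) k.

Definition r (n : nat) (i j : 'I_n.+1) (s : seq (properSubset n)) (k : nat) :
    polyA n :=
  let between (A : properSubset n) :=
    (chain_nth s k.-1 \proper pset A) && (pset A \proper chain_nth s k) in
  (\sum_(A : properSubset n | [&& between A, i \in pset A & j \notin pset A]) l A
   - \sum_(A : properSubset n | [&& between A, j \in pset A & i \notin pset A]) l A)
  * chain_monomial s.

Definition r_gen (n : nat) (p : polyA n) : Prop :=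
  exists (s : seq (properSubset n)) (k : nat) (i j : 'I_n.+1),
    [/\ is_chain s, (1 <= k <= (size s).+1)%N,
        i \in chain_nth s k :\: chain_nth s k.-1,
        j \in chain_nth s k :\: chain_nth s k.-1 & i != j]
    /\ p = r i j s k.
Arguments r_gen n _ : clear implicits.

(* [k : 'I_n] stands for the position k+1 of {1, ..., n}. *)
Definition Desc (n : nat) (sigma : 'S_n.+1) : {set 'I_n} :=
  [set k : 'I_n | (sigma (widen_ord (leqnSn n) k) > sigma (lift ord0 k))%N].

Definition initial_set (n : nat) (sigma : 'S_n.+1) (k : 'I_n) :
    {set 'I_n.+1} :=
  [set sigma i | i in [set i : 'I_n.+1 | (i <= k)%N]].

Lemma initial_set_proper (n : nat) (sigma : 'S_n.+1) (k : 'I_n) :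
  (initial_set sigma k != set0) && (initial_set sigma k != setT).
Proof.
apply/andP; split.
  by apply/set0Pn; exists (sigma ord0); apply: imset_f; rewrite inE.
apply/negP => /eqP E.
have : sigma ord_max \in initial_set sigma k by rewrite E inE.
rewrite /initial_set mem_imset; last exact: perm_inj.
by rewrite inE leqNgt ltn_ord.
Qed.

Definition initial (n : nat) (sigma : 'S_n.+1) (k : 'I_n) : properSubset n :=
  ProperSubset (initial_set_proper sigma k).

Definition lmon (n : nat) (sigma : 'S_n.+1) : polyA n :=
  \prod_(k : 'I_n | k \notin Desc sigma) l (initial sigma k).

Lemma lmon_in_G (n : nat) (sigma : 'S_n.+1) : lmon sigma \in G n.
Proof.
pose ks := [seq k <- enum 'I_n | k \notin Desc sigma].
apply/asboolP; exists [:: (1, lmon sigma)]; split; last first.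
  by rewrite big_seq1 mulr1z.
move=> u; rewrite inE => /eqP -> /=.
exists [seq initial sigma k | k <- ks]; split; last first.
  by rewrite /chain_monomial big_map big_filter big_enum_cond.
rewrite /is_chain sorted_map.
apply: (@sub_sorted _ (fun k k' : 'I_n => (k < k')%N)); last first.
  apply: sorted_filter; first by move=> a b c; apply: ltn_trans.
  have : sorted ltn [seq val k | k <- enum 'I_n].
    by rewrite val_enum_ord iota_ltn_sorted.
  by rewrite sorted_map.
move=> k k' kk' /=; apply/properP; split.
  apply: imsetS; apply/subsetP => i; rewrite !inE => /leq_trans; apply.
  exact: ltnW.
exists (sigma (widen_ord (leqnSn n) k')).
  by apply: imset_f; rewrite inE.
rewrite /= /initial_set mem_imset; last exact: perm_inj.
by rewrite inE /= -ltnNge.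
Qed.

Definition l_sigma (n : nat) (sigma : 'S_n.+1) : Gmod n :=
  GmodOf (lmon_in_G sigma).

(* Main.v *)
Require Import Defs.
From HB Require Import structures.
From mathcomp Require Import all_boot all_order all_fingroup all_algebra.
From mathcomp Require Import mpoly.
From mathcomp Require Import boolp zify.

(** A chain is handled as a set [S] of pairwise nested proper subsets, with
    monomial [mon S], and the relation r_{i,j} as [block_rel S i j], where no
    member of [S] contains exactly one of [i] and [j].  The proof rests on two
    facts.

    Straightening ([straightening]).  List each block of a chain in decreasing
    order and concatenate.  If there is an ascent at every junction of two
    blocks, the resulting word is a permutation sigma and the monomial is
    l^sigma.  Otherwise some member [A] of [S] has its two neighbouring blocks
    in decreasing order; let [x] be the last element of the first one and [y]
    the first element of the second one.  The relation r_{x,y} of [S] minus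
    [A] expresses [mon S] by monomials in which [A] is replaced by another set
    [C] containing exactly one of [x] and [y], and each such [C] separates a
    new pair a < b (a inside, b outside).  Counting the separated pairs gives
    termination.  So the l^sigma generate [G] modulo the r's.

    Localization ([lmon_free_mod_R12]).  The torus fixed points of the variety
    are indexed by permutations tau; restricting equivariant cohomology to a
    fixed point, along a generic one-parameter subgroup, is a ring morphism
    [localize tau] from the polynomial ring to Z[X] that kills the generators
    of R_2 and sends the generator of R_1 attached to (i, j) to (i - j) X,
    independently of tau.  Straightening, with an induction on the degree,
    shows that the vector of localizations of any polynomial is a
    Z[X]-combination of those of the l^sigma ([all_spanned]); for an element
    of R_1 + R_2 the coefficients are multiples of X ([R12_spanned]).  The
    localizations of the l^sigma are triangular with respect to inclusion of
    the sets of noninversions, with nonzero diagonal, hence free over Z[X]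
    ([localize_lmon_free]).  So an integral combination of the l^sigma lying in
    R_1 + R_2 has coefficients that are constants divisible by X, that is, 0.

    The r's lie in U.  An element p of U is a combination of the l^sigma plus
    a combination of r's; the first part lies in U, so it is zero, and p is a
    combination of r's. *)

Set Implicit Arguments.
Unset Strict Implicit.
Unset Printing Implicit Defensive.

Import GRing.Theory.
Local Open Scope ring_scope.

(** * Chains, their blocks and the reading order *)

Definition sep n (a b : 'I_n.+1) (A : properSubset n) : bool :=
  (a \in pset A) && (b \notin pset A).

Definition nested n (A B : properSubset n) : bool :=
  (pset A \subset pset B) || (pset B \subset pset A).

Definition chain n (S : {set properSubset n}) : Prop :=
  {in S &, forall A B, nested A B}.

Definition mon n (S : {set properSubset n}) : polyA n := \prod_(A in S) l A.

(** The index, counted from 0, of the block of the chain [S] that contains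
    [a]. *)
Definition blk n (S : {set properSubset n}) (a : 'I_n.+1) : nat :=
  #|[set A in S | a \notin pset A]|.

(** The reading order of [S]: block after block, each block in decreasing
    order.  It is the lexicographic order on (block, - value), packed into one
    natural number so that sorting and extrema apply. *)
Definition key n (S : {set properSubset n}) (a : 'I_n.+1) : nat :=
  blk S a * n.+1 + (n - a).

Lemma nested_sym n (A B : properSubset n) : nested A B = nested B A.
Proof. by rewrite /nested orbC. Qed.

Lemma nested_sep n (A B : properSubset n) a b :
  nested A B -> sep a b A -> sep b a B = false.
Proof.
case/orP=> /subsetP sub /andP[aA bA]; rewrite /sep; apply/negP => /andP[bB aB].
  by rewrite sub in aB.
by rewrite sub in bA.
Qed.

Lemma chain_sub n (S S' : {set properSubset n}) :
  S' \subset S -> chain S -> chain S'.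
Proof. by move=> /subsetP sub cS A B /sub AS /sub BS; exact: cS. Qed.

Lemma chainU1 n (A : properSubset n) (S : {set properSubset n}) :
  chain S -> {in S, forall B, nested A B} -> chain (A |: S).
Proof.
move=> cS cA B C; rewrite !inE => /orP[/eqP->|BS] /orP[/eqP->|CS].
- by rewrite /nested subxx.
- exact: cA.
- by rewrite nested_sym; apply: cA.
- exact: cS.
Qed.

Lemma blk_le n (S : {set properSubset n}) a b :
  (forall A, A \in S -> ~~ sep a b A) -> (blk S b <= blk S a)%N.
Proof.
move=> h; apply/subset_leq_card/subsetP => A; rewrite !inE => /andP[AS bA].
by rewrite AS; move: (h A AS); rewrite /sep bA andbT.
Qed.

Lemma blk_lt n (S : {set properSubset n}) A a b :
  chain S -> A \in S -> sep a b A -> (blk S a < blk S b)%N.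
Proof.
move=> cS AS /andP[aA bA]; apply/proper_card/properP; split.
  apply/subsetP => B; rewrite !inE => /andP[BS aB]; rewrite BS.
  apply/negP => bB; have := cS A B AS BS.
  case/orP=> /subsetP sub; first by rewrite sub in aB.
  by rewrite sub in bA.
by exists A; rewrite !inE AS // aA.
Qed.

Lemma blk_lt_sep n (S : {set properSubset n}) a b :
  (blk S a < blk S b)%N -> exists2 A, A \in S & sep a b A.
Proof.
move=> lt; case: (boolP [exists A in S, sep a b A]) => [/exists_inP[A]|].
  by exists A.
move/exists_inPn=> h; have := blk_le h; lia.
Qed.

Lemma key_blk n (S : {set properSubset n}) a b :
  (key S a <= key S b)%N -> (blk S a <= blk S b)%N.
Proof.
rewrite /key => h; rewrite leqNgt; apply/negP => lt.
have := leq_mul lt (leqnn n.+1); have := ltn_ord a; have := ltn_ord b; lia.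
Qed.

Lemma key_ord n (S : {set properSubset n}) a b :
  (key S a <= key S b)%N -> blk S a = blk S b -> (b <= a)%N.
Proof.
rewrite /key => h e; rewrite e in h; have := ltn_ord a; have := ltn_ord b; lia.
Qed.

Lemma key_inj n (S : {set properSubset n}) : injective (key S).
Proof.
move=> a b e; apply/val_inj => /=.
have e1 : blk S a = blk S b.
  by apply/eqP; rewrite eqn_leq !key_blk // e.
by apply/eqP; rewrite eqn_leq !(@key_ord _ S) // e.
Qed.

Lemma key_lt_of_blk n (S : {set properSubset n}) a b :
  (blk S a < blk S b)%N -> (key S a < key S b)%N.
Proof. by move=> lt; rewrite ltnNge; apply/negP => /key_blk; lia. Qed.

(** [A] being a member of the chain [S], [x] is read last before the end of
    [A] and [y] is read next: [x] is the least element of the block that ends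
    with [A] and [y] is the greatest element of the following block. *)
Record junction n (S : {set properSubset n}) A (x y : 'I_n.+1) : Prop :=
  Junction {
    junction_in : x \in pset A;
    junction_out : y \notin pset A;
    junction_last : forall c, c \in pset A -> (key S c <= key S x)%N;
    junction_first : forall c, c \notin pset A -> (key S y <= key S c)%N }.

Lemma junction_exists n (S : {set properSubset n}) A :
  exists x y, junction S A x y.
Proof.
have /andP[/set0Pn[x0 x0A]] := psetP A.
rewrite -subTset => /subsetPn[y0 _ y0A].
have [x xA xm] := @arg_maxnP _ x0 (mem (pset A)) (key S) x0A.
have [y yA ym] := @arg_minnP _ y0 [pred y | y \notin pset A] (key S) y0A.
by exists x, y; split.
Qed.

(** [x] and [y] lie in consecutive blocks: another member [D] that contains
    [x] and not [y] would leave out an element of [A] of a later block than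
    [x], or contain an element outside [A] of an earlier block than [y]. *)
Lemma junction_sep n (S : {set properSubset n}) A x y :
  chain S -> A \in S -> junction S A x y ->
  {in S, forall D, sep x y D -> D = A}.
Proof.
move=> cS AS [xA yA xm ym] D DS /andP[xD yD]; apply/val_inj/eqP => /=.
rewrite eqEsubset; apply/andP; split; apply/subsetP => c.
  move=> cD; apply/negPn/negP => cA.
  have := key_blk (ym c cA); have : sep c y D by rewrite /sep cD.
  by move/(blk_lt cS DS); lia.
move=> cA; apply/negPn/negP => cD.
have := key_blk (xm c cA); have : sep x c D by rewrite /sep xD.
by move/(blk_lt cS DS); lia.
Qed.

(** * Permutations, their ascents and noninversions *)

(** The rank of [a], the number of elements of smaller value, is injective
    on the ground set, hence a permutation; sigma is its inverse. *)
Lemma sorting_perm n (f : 'I_n.+1 -> nat) : injective f ->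
  exists sigma : 'S_n.+1,
    forall a b, ((sigma^-1)%g a < (sigma^-1)%g b)%N = (f a < f b)%N.
Proof.
move=> fI; pose before a := [set c | (f c < f a)%N].
have cardlt a : (#|before a| < n.+1)%N.
  rewrite -[X in (_ < X)%N]card_ord -cardsT; apply/proper_card/properP.
  by split; [apply: subsetT | exists a; rewrite !inE ?ltnn].
have lt a b : (f a < f b)%N -> (#|before a| < #|before b|)%N.
  move=> h; apply/proper_card/properP; split.
    by apply/subsetP => c; rewrite !inE => /ltn_trans; apply.
  by exists a; rewrite !inE ?ltnn.
have ltE a b : (#|before a| < #|before b|)%N = (f a < f b)%N.
  apply/idP/idP; last exact: lt.
  case: (ltngtP (f a) (f b)) => // [/lt|/fI ->]; lia.
have posI : injective (fun a => Ordinal (cardlt a)).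
  move=> a b /(congr1 val) /= e; apply: fI.
  by have := ltE a b; have := ltE b a; rewrite e ltnn; lia.
by exists ((perm posI)^-1)%g => a b; rewrite invgK !permE /= ltE.
Qed.

Lemma mem_initial n (sigma : 'S_n.+1) k a :
  (a \in pset (initial sigma k)) = ((sigma^-1)%g a <= k)%N.
Proof.
rewrite /= /initial_set; apply/imsetP/idP => [[i]|h].
  by rewrite inE => ik ->; rewrite permK.
by exists ((sigma^-1)%g a); rewrite ?inE ?permKV.
Qed.

Lemma initial_inj n (sigma : 'S_n.+1) : injective (initial sigma).
Proof.
move=> k k' e; apply/val_inj/eqP; rewrite eqn_leq /=.
have h j : (j < n.+1)%N -> (j <= k)%N = (j <= k')%N.
  move=> jn; have /setP/(_ (sigma (Ordinal jn))) := congr1 (@pset n) e.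
  by rewrite !mem_initial permK.
have kn := ltn_ord k; have kn' := ltn_ord k'.
by rewrite -(h k) ?(h k') ?leqnn //; exact: leqW.
Qed.

Lemma initial_nested n (sigma : 'S_n.+1) k k' :
  nested (initial sigma k) (initial sigma k').
Proof.
rewrite /nested; case/orP: (leq_total k k') => h; apply/orP; [left|right];
  apply/subsetP => a; rewrite !mem_initial => /leq_trans; exact.
Qed.

(** The chain whose monomial is l^sigma. *)
Definition ascents n (sigma : 'S_n.+1) : {set properSubset n} :=
  [set initial sigma k | k in ~: Desc sigma].

Lemma lmonE n (sigma : 'S_n.+1) : lmon sigma = mon (ascents sigma).
Proof.
rewrite /mon /ascents big_imset => [|k k' _ _]; last exact: initial_inj.
by apply: eq_bigl => k; rewrite !inE.
Qed.

(** The chains that need no straightening: sigma is the reading order of [S].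
    Every member of [S] is an initial set of sigma and, by hypothesis, there is
    an ascent where it ends; conversely sigma decreases inside the blocks, so
    each of its ascents is the end of a member of [S]. *)
Lemma ascending_chain_ascents n (S : {set properSubset n}) : chain S ->
  (forall A x y, A \in S -> junction S A x y -> (x < y)%N) ->
  exists sigma : 'S_n.+1, S = ascents sigma.
Proof.
move=> cS good; have [sigma ltE] := sorting_perm (@key_inj n S); exists sigma.
pose p a : nat := (sigma^-1)%g a.
have leE a b : (p a <= p b)%N = (key S a <= key S b)%N.
  by rewrite leqNgt ltE -leqNgt.
have initialP A x y (xn : (p x < n)%N) : A \in S -> junction S A x y ->
    A = initial sigma (Ordinal xn) /\ y = sigma (lift ord0 (Ordinal xn)).
  move=> AS [xA yA xm ym]; have eA : A = initial sigma (Ordinal xn).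
    apply/val_inj/setP => c /=; rewrite -[RHS]/(c \in pset (initial sigma _)).
    rewrite mem_initial /= leE; apply/idP/idP => [|h]; first exact: xm.
    apply/negPn/negP => cA; have : sep x c A by rewrite /sep xA.
    by move/(blk_lt cS AS)/key_lt_of_blk; rewrite ltnNge h.
  split=> //; pose z := sigma (lift ord0 (Ordinal xn)); rewrite -/z.
  suff /eqP/val_inj/perm_inj : p y == p z by [].
  have pz : p z = (p x).+1 by rewrite /p permK /= /bump leq0n add1n.
  have zA : z \notin pset A by rewrite eA mem_initial -/(p z) /= pz ltnn.
  rewrite eqn_leq leE ym //= pz ltnNge leE -ltnNge; apply: key_lt_of_blk.
  by apply: (blk_lt cS AS); rewrite /sep xA.
apply/setP => A; apply/idP/imsetP => [AS|[k]].
  have [x [y J]] := junction_exists S A; have [xA yA xm ym] := J.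
  have xn : (p x < n)%N.
    rewrite -ltnS; apply: leq_ltn_trans (ltn_ord ((sigma^-1)%g y)).
    rewrite -/(p y) ltE; apply/key_lt_of_blk/(blk_lt cS AS).
    by rewrite /sep xA.
  have [eA ey] := initialP A x y xn AS J; exists (Ordinal xn) => //.
  rewrite !inE -leqNgt -ey; apply/ltnW/(leq_ltn_trans _ (good A x y AS J)).
  rewrite (_ : widen_ord _ _ = (sigma^-1)%g x) ?permKV //; exact/val_inj.
rewrite !inE -leqNgt => kasc ->.
set x := sigma (widen_ord _ _) in kasc; set y := sigma (lift _ _) in kasc.
have px : p x = k by rewrite /p permK.
have py : p y = k.+1 by rewrite /p permK /= /bump leq0n add1n.
have xy : (key S x <= key S y)%N by rewrite -leE px py.
have /blk_lt_sep[D DS /andP[xD yD]] : (blk S x < blk S y)%N.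
  rewrite ltn_neqAle key_blk // andbT; apply/negP => /eqP e.
  have yx := key_ord xy e.
  have : x = y by apply/val_inj/eqP; rewrite eqn_leq kasc.
  by move/(congr1 p); rewrite px py; lia.
have [x' [y' J]] := junction_exists S D; have [x'D y'D x'm y'm] := J.
have px' : p x' = k.
  apply/eqP; rewrite eqn_leq -{2}px leE x'm // andbT -ltnS -py ltE.
  apply: leq_trans (y'm _ yD); apply/key_lt_of_blk/(blk_lt cS DS).
  by rewrite /sep x'D.
have xn : (p x' < n)%N by rewrite px'.
have [eD _] := initialP D x' y' xn DS J.
by rewrite (_ : k = Ordinal xn) -?eD //; apply/val_inj; rewrite /= px'.
Qed.

Definition noninv n (sigma : 'S_n.+1) : {set 'I_n.+1 * 'I_n.+1} :=
  [set p : 'I_n.+1 * 'I_n.+1 |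
    (p.1 < p.2)%N && ((sigma^-1)%g p.1 < (sigma^-1)%g p.2)%N].

(** Comparing the positions of all pairs of elements determines the position
    of each element, as the number of elements before it. *)
Lemma noninv_inj n : injective (@noninv n).
Proof.
move=> sigma tau /setP e; apply/invg_inj.
pose s := (sigma^-1)%g; pose t := (tau^-1)%g; rewrite -/s -/t.
have lt a b : (s a < s b)%N = (t a < t b)%N.
  case: (ltngtP a b) => [ab|ba|/val_inj->]; last by rewrite !ltnn.
    by have := e (a, b); rewrite !inE /= ab.
  have := e (b, a); rewrite !inE /= ba /= -/s -/t => h.
  have neq (u : 'S_n.+1) : (u a != u b :> nat).
    rewrite (inj_eq val_inj) (inj_eq perm_inj).
    by apply: contraTneq ba => ->; rewrite ltnn.
  have sN := neq s; have tN := neq t.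
  by move: h sN tN; clear; lia.
have cardE (u : 'S_n.+1) a : #|[set c | (u c < u a)%N]| = u a.
  rewrite -(card_imset _ (@perm_inj _ u)).
  rewrite (_ : _ @: _ = [set c : 'I_n.+1 | (c < u a)%N]).
    rewrite cardsE -sum1_card (eq_bigl (fun c : 'I_n.+1 => (c < u a)%N)) //.
    have le : (u a <= n.+1)%N by apply: ltnW.
    by rewrite (big_ord_narrow le) sum1_card card_ord.
  apply/setP => c; apply/imsetP/idP => [[d]|]; rewrite !inE.
    by move=> h ->.
  by exists ((u^-1)%g c); rewrite ?inE ?permKV.
apply/permP => a; apply/val_inj; rewrite /= -(cardE s) -(cardE t).
by apply: eq_card => c; rewrite !inE lt.
Qed.

(** If a < b and [a] comes before [b] in sigma, then sigma has an ascent
    between them; the corresponding initial set contains [a] and not [b], and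
    as an initial set of tau it puts [a] before [b] in tau. *)
Lemma ascents_noninv n (sigma tau : 'S_n.+1) :
  (forall A, A \in ascents sigma -> exists k, A = initial tau k) ->
  noninv sigma \subset noninv tau.
Proof.
move=> h; apply/subsetP => -[a b]; rewrite !inE /= => /andP[ab sab].
rewrite ab /=.
suff /exists_inP[k kD /andP[ka kb]] :
    [exists k in ~: Desc sigma, ((sigma^-1)%g a <= k < (sigma^-1)%g b)%N].
  have [k' ek] := h _ (imset_f (initial sigma) kD).
  have : sep a b (initial sigma k) by rewrite /sep !mem_initial ka -ltnNge.
  rewrite ek /sep !mem_initial -ltnNge => /andP[]; exact: leq_ltn_trans.
apply: contraT => /exists_inPn noasc.
(* without an ascent, sigma decreases from the position of [a] to that of [b] *)
have desc m : ((sigma^-1)%g a + m < n.+1)%N ->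
    ((sigma^-1)%g a + m <= (sigma^-1)%g b)%N ->
    (sigma (inord ((sigma^-1)%g a + m)) <= a)%N.
  elim: m => [|m IH] lt le; first by rewrite addn0 inord_val permKV.
  have kn : ((sigma^-1)%g a + m < n)%N by lia.
  have := noasc (Ordinal kn); rewrite !inE /= leq_addr -addnS le => desc.
  have : (sigma (lift ord0 (Ordinal kn))
          <= sigma (widen_ord (leqnSn n) (Ordinal kn)))%N.
    by apply: ltnW; apply: contraT => /desc.
  rewrite (_ : lift _ _ = inord ((sigma^-1)%g a + m.+1)); last first.
    by apply/val_inj; rewrite /= inordK // /bump leq0n; lia.
  rewrite (_ : widen_ord _ _ = inord ((sigma^-1)%g a + m)); last first.
    by apply/val_inj; rewrite /= inordK //; lia.
  by move/leq_trans; apply; apply: IH; lia.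
have := desc ((sigma^-1)%g b - (sigma^-1)%g a)%N.
rewrite subnKC ?(ltnW sab) // inord_val permKV.
move=> /(_ (ltn_ord _) (leqnn _)); lia.
Qed.

(** * Straightening chain monomials *)

Definition subgroup (M : zmodType) (P : M -> Prop) : Prop :=
  P 0 /\ forall x y, P x -> P y -> P (x - y).

Lemma subgroupD (M : zmodType) (P : M -> Prop) x y :
  subgroup P -> P x -> P y -> P (x + y).
Proof.
move=> [P0 PB] Px Py; have PN : P (- y) by rewrite -sub0r; exact: PB.
by rewrite -[y]opprK; exact: PB.
Qed.

Lemma subgroup_sum (M : zmodType) (P : M -> Prop) (I : finType) (Q : pred I)
    (F : I -> M) :
  subgroup P -> (forall i, Q i -> P (F i)) -> P (\sum_(i | Q i) F i).
Proof.
by move=> gP h; apply: big_ind => // [|x y]; [case: gP | exact: subgroupD].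
Qed.

Definition extends n (A : properSubset n) (S : {set properSubset n}) : bool :=
  [forall B in S, nested A B].

(** The relation r_{i,j} of the chain [S]: since [A] separates [i] from [j],
    it lies between the ends of the block of [i] and [j] as soon as it is
    nested with all members of [S]. *)
Definition block_rel n (S : {set properSubset n}) (i j : 'I_n.+1) : polyA n :=
  (\sum_(A | sep i j A && extends A S) l A
   - \sum_(A | sep j i A && extends A S) l A) * mon S.

(** [i] and [j] lie in the same block of the chain [S]. *)
Definition unsep n (S : {set properSubset n}) (i j : 'I_n.+1) : Prop :=
  forall A, A \in S -> (i \in pset A) = (j \in pset A).

Lemma unsep_sym n (S : {set properSubset n}) i j : unsep S i j -> unsep S j i.
Proof. by move=> h A /h. Qed.

Lemma unsep_notin n (S : {set properSubset n}) i j A :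
  unsep S i j -> sep i j A -> A \notin S.
Proof.
by move=> h /andP[iA jA]; apply/negP => /h; rewrite iA (negbTE jA).
Qed.

Lemma monU1 n (S : {set properSubset n}) A :
  A \notin S -> mon (A |: S) = l A * mon S.
Proof. exact: big_setU1. Qed.

(** The noninversions of the reading word of the chain [S]; being read off
    the members of [S], they only grow with [S]. *)
Definition separated_pairs n (S : {set properSubset n}) :
    {set 'I_n.+1 * 'I_n.+1} :=
  [set p : 'I_n.+1 * 'I_n.+1 |
    (p.1 < p.2)%N && [exists A in S, sep p.1 p.2 A]].

Definition separated_count n (S : {set properSubset n}) : nat :=
  #|separated_pairs S|.

Lemma noninv_count_max n (S : {set properSubset n}) :
  (separated_count S <= n.+1 * n.+1)%N.
Proof. by rewrite -[n.+1]card_ord -card_prod; exact: max_card. Qed.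

Lemma separated_pairsS n (S S' : {set properSubset n}) :
  S \subset S' -> separated_pairs S \subset separated_pairs S'.
Proof.
move=> /subsetP sub; apply/subsetP => p.
rewrite !inE => /andP[->] /exists_inP[A AS h].
by apply/exists_inP; exists A => //; exact: sub.
Qed.

Lemma separated_countU1 n (S : {set properSubset n}) C (a b : 'I_n.+1) :
  (a < b)%N -> sep a b C -> unsep S a b ->
  (separated_count S < separated_count (C |: S))%N.
Proof.
move=> ab sC h; apply/proper_card/properP; split.
  exact/separated_pairsS/subsetUr.
exists (a, b); rewrite inE /= ab /=.
  by apply/exists_inP; exists C => //; rewrite !inE eqxx.
by apply/exists_inPn => A AS; apply/negP => /(unsep_notin h); rewrite AS.
Qed.

(** A pair a < b separated by [A] alone would consist of an element of the
    block of [x] and an element of the block of [y]; then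
    x <= a < b <= y, against the descent. *)
Lemma descent_separated_pairs n (S : {set properSubset n}) A (x y : 'I_n.+1) :
  chain S -> A \in S -> junction S A x y -> (y <= x)%N ->
  separated_pairs (S :\ A) = separated_pairs S.
Proof.
move=> cS AS [xA yA xm ym] yx; apply/eqP.
rewrite eqEsubset separated_pairsS ?subsetDl //=.
apply/subsetP => -[a b]; rewrite !inE /= => /andP[ab /exists_inP[B BS sB]].
rewrite ab /=; have [eB|nB] := eqVneq B A; last first.
  by apply/exists_inP; exists B; rewrite // !inE nB.
apply: contraT => /exists_inPn noD; subst B; have /andP[aA bA] := sB.
have other D : D \in S -> D != A -> ~~ sep a b D.
  by move=> DS DA; apply: noD; rewrite !inE DA.
have bxa : (blk S x <= blk S a)%N.
  apply: blk_le => D DS; apply/negP => /andP[aD xD].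
  have DA : D != A by apply: contraNneq xD => ->.
  have := other D DS DA; rewrite /sep aD negbK => bD.
  case/orP: (cS D A DS AS) => /subsetP sub; last by rewrite sub in xD.
  by rewrite sub in bA.
have bby : (blk S b <= blk S y)%N.
  apply: blk_le => D DS; apply/negP => /andP[yD bD].
  have DA : D != A by apply: contraNneq yA => <-.
  have := other D DS DA; rewrite /sep bD andbT => aD.
  case/orP: (cS D A DS AS) => /subsetP sub; first by rewrite sub in yA.
  by rewrite sub in aD.
have ax := xm a aA; have yb := ym b bA.
have xa : (x <= a)%N by apply: (key_ord ax); have := key_blk ax; lia.
have by' : (b <= y)%N by apply: (key_ord yb); have := key_blk yb; lia.
lia.
Qed.

Lemma junction_unsep n (S : {set properSubset n}) A x y :
  chain S -> A \in S -> junction S A x y -> unsep (S :\ A) x y.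
Proof.
move=> cS AS J D; rewrite !inE => /andP[DA DS]; have [xA yA _ _] := J.
apply/idP/idP => h; apply: contraT => h'.
  by rewrite (junction_sep cS AS J DS) ?eqxx // /sep h in DA.
have := @nested_sep _ _ _ x y (cS A D AS DS).
by rewrite /sep xA yA h h' => /(_ isT).
Qed.

(** At a descent, [A] cuts the union of its two neighbouring blocks into its
    greatest and its smallest elements, which separates no pair.  If [C]
    contains [y] and not [x], it separates the pair y < x.  If it contains [x]
    and not [y] but differs from [A], then it leaves out some c > x of [A], or
    contains some c < y outside [A]. *)
Lemma resplit_separated_count n (S : {set properSubset n}) A (x y : 'I_n.+1) C :
  chain S -> A \in S -> junction S A x y -> (y < x)%N ->
  extends C (S :\ A) -> C != A -> sep x y C || sep y x C ->
  (separated_count S < separated_count (C |: S :\ A))%N.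
Proof.
move=> cS AS J yx ext CA; have U := junction_unsep cS AS J.
rewrite /separated_count -(descent_separated_pairs cS AS J (ltnW yx)).
rewrite -!/(separated_count _).
have nest D : D \in S -> D != A -> nested C D.
  by move=> DS DA; apply: (forall_inP ext); rewrite !inE DA.
case/orP=> sC; last exact: separated_countU1 (unsep_sym U).
have /andP[xC yC] := sC; have [xA yA xm ym] := J.
have blk_unsep c d : blk S c = blk S d -> unsep S c d.
  move=> e D DS; apply/idP/idP => h; apply: contraT => h'.
    by have := @blk_lt _ S D c d cS DS; rewrite /sep h h' e ltnn => /(_ isT).
  by have := @blk_lt _ S D d c cS DS; rewrite /sep h h' e ltnn => /(_ isT).
have unsepD c d : blk S c = blk S d -> unsep (S :\ A) c d.
  by move=> /blk_unsep h D; rewrite !inE => /andP[_ /h].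
have [sub|/subsetPn[c cC cA]] := boolP (pset C \subset pset A).
  have /subsetPn[c cA cC] : ~~ (pset A \subset pset C).
    apply: contraNN CA => sub'; apply/eqP/val_inj/eqP.
    by rewrite eqEsubset sub.
  have e : blk S x = blk S c.
    apply/eqP; rewrite eqn_leq (key_blk (xm c cA)) andbT.
    apply: blk_le => D DS; apply/negP => /andP[cD xD].
    have DA : D != A by apply: contraNneq xD => ->.
    case/orP: (nest D DS DA) => /subsetP sb; first by rewrite sb in xD.
    by rewrite sb in cC.
  have xc := key_ord (xm c cA) (esym e).
  apply: (@separated_countU1 _ _ _ x c); [|by rewrite /sep xC|exact: unsepD].
  by rewrite ltn_neqAle xc andbT; apply: contraNneq cC => /val_inj <-.
have e : blk S c = blk S y.
  apply/eqP; rewrite eqn_leq (key_blk (ym c cA)) andbT.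
  apply: blk_le => D DS; apply/negP => /andP[yD cD].
  have DA : D != A by apply: contraNneq yA => <-.
  case/orP: (nest D DS DA) => /subsetP sb; first by rewrite sb in cD.
  by rewrite sb in yC.
have cy := key_ord (ym c cA) (esym e).
apply: (@separated_countU1 _ _ _ c y); [|by rewrite /sep cC|exact: unsepD].
by rewrite ltn_neqAle cy andbT; apply: contraNneq yC => /val_inj <-.
Qed.

(** The degree [d] is kept as a parameter because [all_spanned] needs the
    relations whose chain has one element less, one degree at a time. *)
Lemma straightening n (P : polyA n -> Prop) d :
  subgroup P -> (forall sigma, P (lmon sigma)) ->
  (forall S i j, chain S -> #|S|.+1 = d -> i != j -> unsep S i j ->
    P (block_rel S i j)) ->
  forall S, chain S -> #|S| = d -> P (mon S).
Proof.
move=> gP Plmon Prel S.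
have [m le] := ubnP (n.+1 * n.+1 - separated_count S).
elim: m S le => // m IH S le cS Sd.
have [good|] :=
    pselect (forall A x y, A \in S -> junction S A x y -> (x < y)%N).
  by have [sigma ->] := ascending_chain_ascents cS good; rewrite -lmonE.
move=> /existsNP[A /existsNP[x /existsNP[y]]] /not_implyP[AS].
move=> /not_implyP[J nxy].
have [xA yA _ _] := J; have sA : sep x y A by rewrite /sep xA.
have xny : x != y by apply: contraNneq yA => <-.
have yx : (y < x)%N.
  by move: nxy xny; rewrite -(inj_eq val_inj) /=; case: ltngtP.
have U := junction_unsep cS AS J.
have cS' : chain (S :\ A) by apply: chain_sub cS; exact: subsetDl.
have S'd : #|S :\ A|.+1 = d by rewrite -Sd (cardsD1 A S) AS.
have PC C : extends C (S :\ A) -> C != A -> sep x y C || sep y x C ->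
    P (l C * mon (S :\ A)).
  move=> ext CA sC; have CS : C \notin S :\ A.
    by case/orP: sC; apply: unsep_notin => //; exact: unsep_sym.
  rewrite -monU1 //; apply: IH; last by rewrite cardsU1 CS.
    have drop w u v : (w - u < m.+1 -> u < v -> v <= w -> w - v < m)%N by lia.
    apply: drop le _ (noninv_count_max _).
    exact: resplit_separated_count cS AS J yx ext CA sC.
  by apply: chainU1 => // B BS; exact: (forall_inP ext).
have -> : mon S = block_rel (S :\ A) x y
    - (\sum_(C | sep x y C && extends C (S :\ A) && (C != A)) l C * mon (S :\ A)
       - \sum_(C | sep y x C && extends C (S :\ A)) l C * mon (S :\ A)).
  have extA : extends A (S :\ A).
    by apply/forall_inP => B; rewrite !inE => /andP[_ BS]; exact: cS.
  rewrite /block_rel [X in (X - _) * _](bigD1 A) ?sA //=.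
  rewrite -[in LHS](setD1K AS) monU1 ?setD11 //.
  by rewrite mulrBl mulrDl -!mulr_suml opprB addrA subrK addrK.
have PB := gP.2; apply: (PB); first exact: Prel.
apply: (PB); apply: subgroup_sum => // C.
  by move=> /andP[/andP[sC ext] CA]; apply: PC => //; rewrite sC.
move=> /andP[sC ext]; apply: PC => //; last by rewrite sC orbT.
by apply: contraTneq sC => ->; rewrite /sep xA andbF.
Qed.

(** * Sequences and sets of nested subsets *)

Lemma proper_pset_trans n :
  transitive (fun A B : properSubset n => pset A \proper pset B).
Proof. by move=> B A C; exact: proper_trans. Qed.

Lemma is_chain_uniq n (s : seq (properSubset n)) : is_chain s -> uniq s.
Proof.
apply: sorted_uniq; first exact: proper_pset_trans.
by move=> A; rewrite properxx.
Qed.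

Lemma chain_monomialE n (s : seq (properSubset n)) :
  uniq s -> chain_monomial s = mon [set A in s].
Proof.
move=> us; rewrite /chain_monomial big_uniq //.
by apply: eq_bigl => A; rewrite inE.
Qed.

Lemma chain_nthS n (s : seq (properSubset n)) k A0 :
  (k < size s)%N -> chain_nth s k.+1 = pset (nth A0 s k).
Proof. by move=> lt; rewrite /chain_nth /= (nth_map A0). Qed.

Lemma chain_nth_end n (s : seq (properSubset n)) k :
  (size s < k)%N -> chain_nth s k = setT.
Proof. by move=> h; rewrite /chain_nth nth_default //= size_map. Qed.

Lemma chain_nth_mono n (s : seq (properSubset n)) k k' :
  is_chain s -> (k <= k')%N -> chain_nth s k \subset chain_nth s k'.
Proof.
move=> cs; have [lt|ge _] := ltnP k' (size s).+1; last first.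
  by rewrite (chain_nth_end ge) subsetT.
rewrite leq_eqVlt => /orP[/eqP->//|].
case: k => [|k]; first by rewrite /chain_nth sub0set.
case: k' lt => // k' lt kk'; case: s cs lt => // A0 s cs lt.
have lt' : (k < size (A0 :: s))%N := ltn_trans kk' lt.
rewrite !(chain_nthS A0) //.
by apply/proper_sub/(sorted_ltn_nth (@proper_pset_trans n) A0 cs).
Qed.

Lemma chain_nth_member n (s : seq (properSubset n)) B : B \in s ->
  exists2 h, (1 <= h <= size s)%N & chain_nth s h = pset B.
Proof.
move=> Bs; exists (index B s).+1; first by rewrite /= index_mem.
by rewrite (chain_nthS B) ?index_mem // nth_index.
Qed.

Lemma member_chain_nth n (s : seq (properSubset n)) h : (1 <= h <= size s)%N ->
  exists2 B, B \in s & chain_nth s h = pset B.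
Proof.
case: h => // h lt; case: s lt => // A0 s lt.
by exists (nth A0 (A0 :: s) h); rewrite ?mem_nth // (chain_nthS A0).
Qed.

Lemma is_chain_chain n (s : seq (properSubset n)) :
  is_chain s -> chain [set A in s].
Proof.
move=> cs A B; rewrite !inE.
move=> /chain_nth_member[h _ eA] /chain_nth_member[k _ eB].
rewrite /nested -eA -eB; have /orP[le|le] := leq_total h k.
  by rewrite chain_nth_mono.
by rewrite orbC chain_nth_mono.
Qed.

Lemma chain_is_chain n (S : {set properSubset n}) : chain S ->
  exists2 s, is_chain s & [set A in s] = S.
Proof.
move=> cS; pose R (A B : properSubset n) := pset A \subset pset B.
have Rtr : transitive R by move=> B A C; exact: subset_trans.
exists (sort R (enum S)); last first.
  by apply/setP => A; rewrite !inE mem_sort mem_enum.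
have srt : sorted R (sort R (enum S)).
  apply: (@sort_sorted_in _ (mem S)); first exact: cS.
  by apply/allP => A; rewrite mem_enum.
have us : uniq (sort R (enum S)) by rewrite sort_uniq enum_uniq.
rewrite /is_chain sorted_pairwise; last exact: proper_pset_trans.
rewrite sorted_pairwise // in srt; rewrite uniq_pairwise in us.
have := conj srt us => /andP; rewrite -pairwise_relI; apply: sub_pairwise.
by move=> A B /= /andP[AB]; rewrite properEneq -/(R A B) AB andbT -val_eqE.
Qed.

(** A set that separates two elements of the [k]-th block is nested with all
    members of the chain exactly when it lies strictly between the ends of
    that block. *)
Lemma r_block_rel n (s : seq (properSubset n)) k i j :
  is_chain s -> (1 <= k <= (size s).+1)%N ->
  i \in chain_nth s k :\: chain_nth s k.-1 ->
  j \in chain_nth s k :\: chain_nth s k.-1 ->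
  unsep [set A in s] i j /\ r i j s k = block_rel [set A in s] i j.
Proof.
case: k => // k cs /= kle; rewrite !inE => /andP[ik ik1] /andP[jk jk1].
have mono := chain_nth_mono cs.
have mem_level a h : a \notin chain_nth s k -> a \in chain_nth s k.+1 ->
    (a \in chain_nth s h) = (k < h)%N.
  move=> ak ak1; apply/idP/idP => [|lt].
    apply: contraLR; rewrite -leqNgt => /mono/subsetP sub.
    by apply: contraNN ak; exact: sub.
  by move/subsetP: (mono _ _ lt); apply.
split.
  move=> A; rewrite inE => /chain_nth_member[h _ <-].
  by rewrite (mem_level i h ik ik1) (mem_level j).
have betweenE a b A : a \notin chain_nth s k -> a \in chain_nth s k.+1 ->
    b \notin chain_nth s k -> b \in chain_nth s k.+1 -> sep a b A ->
    (chain_nth s k \proper pset A) && (pset A \proper chain_nth s k.+1)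
      = extends A [set A in s].
  move=> ak ak1 bk bk1 /andP[aA bA].
  apply/idP/forall_inP => [/andP[lo up] B|ext].
    rewrite inE => /chain_nth_member[h _ eB]; rewrite /nested -eB.
    have [kh|hk] := ltnP k h.
      by rewrite (subset_trans (proper_sub up)) // mono.
    by rewrite orbC (subset_trans _ (proper_sub lo)) // mono.
  have ext' B : B \in s -> nested A B by move=> Bs; apply: ext; rewrite inE.
  apply/andP; split; apply/properP; split; try by [exists a | exists b].
    have [->|k0] := posnP k; first by rewrite /chain_nth sub0set.
    have [|B Bs eB] := @member_chain_nth _ s k; first by rewrite k0.
    case/orP: (ext' B Bs) => /subsetP sub; last by rewrite eB; apply/subsetP.
    by rewrite eB (sub a aA) in ak.
  have [lt|ge] := ltnP (size s) k.+1; first by rewrite chain_nth_end ?subsetT.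
  have [|B Bs eB] := @member_chain_nth _ s k.+1; first by [].
  case/orP: (ext' B Bs) => /subsetP sub; first by rewrite eB; apply/subsetP.
  by rewrite eB in bk1; rewrite (sub b bk1) in bA.
rewrite /r /block_rel /= (chain_monomialE (is_chain_uniq cs)).
congr ((_ - _) * _).
  apply: eq_bigl => A; rewrite andbC -/(sep i j A).
  by case: (boolP (sep i j A)) => //= sA; rewrite (betweenE i j).
apply: eq_bigl => A; rewrite andbC -/(sep j i A).
by case: (boolP (sep j i A)) => //= sA; rewrite (betweenE j i).
Qed.

(** The first set of the augmented chain that contains [i] is also the first
    one that contains [j]. *)
Lemma unsep_block n (s : seq (properSubset n)) i j : unsep [set A in s] i j ->
  exists k, [/\ (1 <= k <= (size s).+1)%N,
    i \in chain_nth s k :\: chain_nth s k.-1 &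
    j \in chain_nth s k :\: chain_nth s k.-1].
Proof.
move=> U; have ex : exists k, i \in chain_nth s k.
  by exists (size s).+1; rewrite chain_nth_end // inE.
have [k ik kmin] := ex_minnP ex.
have iff h : (i \in chain_nth s h) = (j \in chain_nth s h).
  have [->|h0] := posnP h; first by rewrite !inE.
  have [hs|hs] := leqP h (size s); last by rewrite chain_nth_end // !inE.
  have [|B Bs ->] := @member_chain_nth _ s h; first by rewrite h0.
  by apply: U; rewrite inE.
have k0 : (0 < k)%N by rewrite lt0n; apply: contraTneq ik => ->; rewrite inE.
have ik1 : i \notin chain_nth s k.-1.
  by apply/negP => /kmin; rewrite leqNgt prednK // leqnn.
exists k; split; last by rewrite !inE -!iff ik ik1.
  by rewrite k0 kmin // chain_nth_end // inE.
by rewrite !inE ik ik1.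
Qed.

Lemma r_genP n (p : polyA n) : r_gen n p <->
  exists S i j, [/\ chain S, i != j, unsep S i j & p = block_rel S i j].
Proof.
split=> [[s [k [i [j [[cs kle ik jk ij] ->]]]]]|[S [i [j [cS ij U ->]]]]].
  have [U ->] := r_block_rel cs kle ik jk.
  by exists [set A in s], i, j; split=> //; exact: is_chain_chain.
have [s cs eS] := chain_is_chain cS; rewrite -eS in U *.
have [k [kle ik jk]] := unsep_block U; exists s, k, i, j; split=> //.
by have [_ ->] := r_block_rel cs kle ik jk.
Qed.

Lemma G_genP n (p : polyA n) : G_gen n p <-> exists2 S, chain S & p = mon S.
Proof.
split=> [[s [cs ->]]|[S cS ->]].
  exists [set A in s]; first exact: is_chain_chain.
  exact/chain_monomialE/is_chain_uniq.
have [s cs <-] := chain_is_chain cS; exists s; split=> //.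
by rewrite chain_monomialE // is_chain_uniq.
Qed.

(** * Spans and ideals *)

Lemma zspan_gen (M : zmodType) (S : M -> Prop) x : S x -> x \in zspan S.
Proof.
move=> Sx; apply/asboolP; exists [:: (1, x)].
split; last by rewrite big_seq1 mulr1z.
by move=> u; rewrite inE => /eqP ->.
Qed.

Lemma subgroup_mulz (M : zmodType) (P : M -> Prop) x c :
  subgroup P -> P x -> P (x *~ c).
Proof.
move=> gP Px; have PN y : P y -> P (- y).
  by rewrite -sub0r; apply: gP.2; exact: gP.1.
have Pn m : P (x *+ m).
  elim: m => [|m IH]; rewrite ?mulr0n ?mulrS; first exact: gP.1.
  exact: subgroupD.
by case: c => m; rewrite ?NegzE ?mulrNz -pmulrn; [|apply: PN].
Qed.

Lemma zspan_sub (M : zmodType) (S P : M -> Prop) :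
  subgroup P -> (forall x, S x -> P x) -> forall x, x \in zspan S -> P x.
Proof.
move=> gP SP x /asboolP[s [hs ->]]; rewrite big_seq.
apply: big_ind => [|y z|u /hs Su]; [exact: gP.1 | exact: subgroupD |].
by apply: subgroup_mulz => //; exact: SP.
Qed.

Lemma ideal_gen_sub (R : comNzRingType) (S P : R -> Prop) :
  subgroup P -> (forall a x, S x -> P (a * x)) ->
  forall x, x \in ideal_gen S -> P x.
Proof.
move=> gP SP x /asboolP[s [hs ->]]; rewrite big_seq.
apply: big_ind => [|y z|u /hs Su]; [exact: gP.1 | exact: subgroupD |].
exact: SP.
Qed.

Lemma ideal_gen_mul (R : comNzRingType) (S : R -> Prop) a x :
  S x -> a * x \in ideal_gen S.
Proof.
move=> Sx; apply/asboolP; exists [:: (a, x)]; split; last by rewrite big_seq1.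
by move=> u; rewrite inE => /eqP ->.
Qed.

Lemma subgroup_closed (M : zmodType) (K : zmodClosed M) :
  subgroup (fun x => x \in K).
Proof. by split; [exact: rpred0 | move=> x y; exact: rpredB]. Qed.

(** * The relations lie in U *)

Lemma sum_mem_sub n (V : zmodType) (F : properSubset n -> V) i j :
  \sum_(A | i \in pset A) F A - \sum_(A | j \in pset A) F A
  = \sum_(A | sep i j A) F A - \sum_(A | sep j i A) F A.
Proof.
rewrite [X in X - _](bigID (fun A => j \in pset A)) /=.
rewrite [X in _ - X](bigID (fun A => i \in pset A)) /=.
rewrite [X in _ - (X + _)](eq_bigl _ _ (fun A => andbC _ _)).
by rewrite opprD addrACA subrr add0r.
Qed.

Definition theta n (i j : 'I_n.+1) : polyA n :=
  \sum_(A | i \in pset A) l A - \sum_(A | j \in pset A) l A.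

(** The difference collects the products of [mon S] with the variables of the
    sets that are not nested with some member of [S]. *)
Lemma block_rel_theta n (S : {set properSubset n}) i j :
  chain S -> theta i j * mon S - block_rel S i j \in ideal_gen (R2_gen n).
Proof.
move=> cS; rewrite /theta sum_mem_sub /block_rel -mulrBl.
have split a b : \sum_(A | sep a b A) l A =
    \sum_(A | sep a b A && extends A S) l A
    + \sum_(A | sep a b A && ~~ extends A S) l A :> polyA n.
  exact: bigID.
rewrite !split opprD addrACA [X in (X - _) * _]addrC addrK mulrBl !mulr_suml.
have inc A : ~~ extends A S -> l A * mon S \in ideal_gen (R2_gen n).
  case/forall_inPn=> B BS; rewrite negb_or => /andP[nAB nBA].
  rewrite -(setD1K BS) monU1 ?setD11 // mulrA mulrC.
  apply: ideal_gen_mul; by exists A, B.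
by rewrite rpredB // rpred_sum // => A /andP[_]; exact: inc.
Qed.

Lemma block_rel_R12 n (S : {set properSubset n}) i j :
  chain S -> i != j -> block_rel S i j \in R12 n.
Proof.
move=> cS ij; apply/asboolP.
exists (theta i j * mon S), (block_rel S i j - theta i j * mon S); split.
- by rewrite mulrC; apply: ideal_gen_mul; exists i, j.
- by rewrite -opprB rpredN block_rel_theta.
- by rewrite addrC subrK.
Qed.

Lemma block_rel_G n (S : {set properSubset n}) i j :
  chain S -> unsep S i j -> block_rel S i j \in G n.
Proof.
move=> cS U; have inG a b A : unsep S a b -> sep a b A && extends A S ->
    l A * mon S \in G n.
  move=> Uab /andP[sA ext]; rewrite -monU1 ?(unsep_notin Uab) //.
  apply/zspan_gen/G_genP; exists (A |: S) => //.
  by apply: chainU1 => // B BS; exact: (forall_inP ext).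
rewrite /block_rel mulrBl !mulr_suml rpredB // rpred_sum // => A.
  exact: inG.
exact/inG/unsep_sym.
Qed.

(** * Localization at the torus fixed points *)

(** The character t_i - t_j, specialized at t_i = i X. *)
Definition linear_form n (i j : 'I_n.+1) : {poly int} :=
  ((i : nat)%:Z - (j : nat)%:Z)%:P * 'X.

(** The restriction of the divisor class of [A] to the fixed point of tau.
    For [A] the initial set of length k+1 it is the element
    t_{tau(k)} - t_{tau(k+1)} of the basis dual to the rays of the cone of tau,
    specialized at t_i = i X; the specialization is generic because the
    differences of distinct t_i stay nonzero.  The sum has at most one
    term. *)
Definition weight n (tau : 'S_n.+1) (A : properSubset n) : {poly int} :=
  \sum_(k : 'I_n | initial tau k == A)
    linear_form (tau (widen_ord (leqnSn n) k)) (tau (lift ord0 k)).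

Definition localize n (tau : 'S_n.+1) : polyA n -> {poly int} :=
  mmap (@polyC int) (fun i => weight tau (enum_val i)).

HB.instance Definition _ n (tau : 'S_n.+1) :=
  GRing.RMorphism.on (localize tau).

Lemma localize_l n (tau : 'S_n.+1) A : localize tau (l A) = weight tau A.
Proof. by rewrite /localize mmapX mmap1U enum_rankK. Qed.

Lemma localizeZ n (tau : 'S_n.+1) c p :
  localize tau (c *: p) = c%:P * localize tau p.
Proof. exact: mmapZ. Qed.

Lemma weight_neq0 n (tau : 'S_n.+1) A :
  weight tau A != 0 -> exists k, A = initial tau k.
Proof.
move=> nz; have [k /eqP <-|none] := pickP (fun k => initial tau k == A).
  by exists k.
by rewrite /weight big_pred0 // eqxx in nz.
Qed.

Lemma weight_nested n (tau : 'S_n.+1) A B :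
  weight tau A != 0 -> weight tau B != 0 -> nested A B.
Proof.
by move=> /weight_neq0[k ->] /weight_neq0[k' ->]; exact: initial_nested.
Qed.

Lemma localize_R2 n (tau : 'S_n.+1) p :
  p \in ideal_gen (R2_gen n) -> localize tau p = 0.
Proof.
move: p; apply: (@ideal_gen_sub _ _ (fun p => localize tau p = 0)); first split.
- exact: raddf0.
- by move=> x y ex ey; rewrite (raddfB (localize tau)) /= ex ey subr0.
move=> a _ [A [B [nAB nBA ->]]]; rewrite !rmorphM /= !localize_l.
have [->|wA] := eqVneq (weight tau A) 0; first by rewrite mul0r mulr0.
have [->|wB] := eqVneq (weight tau B) 0; first by rewrite !mulr0.
by have := weight_nested wA wB; rewrite /nested (negbTE nAB) (negbTE nBA).
Qed.

Lemma linear_form_neq0 n (i j : 'I_n.+1) : i != j -> linear_form i j != 0.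
Proof.
move=> ij; rewrite mulf_neq0 ?polyX_eq0 // polyC_eq0 subr_eq0 eqz_nat.
by rewrite (inj_eq val_inj).
Qed.

Lemma weight_initial n (tau : 'S_n.+1) k :
  weight tau (initial tau k)
  = linear_form (tau (widen_ord (leqnSn n) k)) (tau (lift ord0 k)).
Proof.
rewrite /weight (eq_bigl (pred1 k)) ?big_pred1_eq // => k'.
exact: (inj_eq (@initial_inj _ tau)).
Qed.

(** A telescoping sum over the positions from that of [i] to the last. *)
Lemma weight_sum n (tau : 'S_n.+1) i :
  \sum_(A | i \in pset A) weight tau A = linear_form i (tau ord_max).
Proof.
rewrite /weight (exchange_big_dep predT) //=.
pose G (m : nat) := ((tau (inord m) : nat)%:Z)%:P * 'X : {poly int}.
transitivity (\sum_(k < n | ((tau^-1)%g i <= k)%N) (G k - G k.+1)).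
  rewrite [RHS]big_mkcond; apply: eq_bigr => k _.
  rewrite -mem_initial.
  have -> : G k - G k.+1
      = linear_form (tau (widen_ord (leqnSn n) k)) (tau (lift ord0 k)).
    rewrite /G /linear_form polyCB mulrBl; congr (_%:Z%:P * _ - _%:Z%:P * _);
    congr (nat_of_ord (tau _)); apply/val_inj; rewrite /= inordK //;
    by have := ltn_ord k; lia.
  case: ifP => ik; last first.
    rewrite big_pred0 // => A; apply/negP => /andP[iA /eqP eA].
    by rewrite eA iA in ik.
  rewrite (eq_bigl (pred1 (initial tau k))) ?big_pred1_eq // => A /=.
  by rewrite eq_sym; case: eqP => [->|]; rewrite ?ik ?andbF.
transitivity (\sum_((tau^-1)%g i <= k < n) (G k - G k.+1)).
  by rewrite big_geq_mkord.
rewrite (eq_bigr (fun k => - (G k.+1 - G k))); last first.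
  by move=> k _; rewrite opprB.
rewrite sumrN telescope_sumr ?opprB; last by rewrite -ltnS.
rewrite /G /linear_form polyCB mulrBl inord_val permKV.
by congr (_ - (_ (tau _))%:Z%:P * _); apply/val_inj; rewrite /= inordK.
Qed.

Lemma localize_theta n (tau : 'S_n.+1) i j :
  localize tau (theta i j) = linear_form i j.
Proof.
have sumE a : localize tau (\sum_(A | a \in pset A) l A)
    = linear_form a (tau ord_max).
  rewrite (raddf_sum (localize tau)) -weight_sum; apply: eq_bigr => A _.
  exact: localize_l.
rewrite (raddfB (localize tau)) /= !sumE /linear_form -mulrBl -polyCB.
by rewrite opprB addrA subrK.
Qed.

Lemma localize_block_rel n (tau : 'S_n.+1) (S : {set properSubset n}) i j :
  chain S ->
  localize tau (block_rel S i j) = linear_form i j * localize tau (mon S).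
Proof.
move=> /(block_rel_theta i j)/(localize_R2 tau)/eqP.
rewrite (raddfB (localize tau)) /= subr_eq0 rmorphM /= localize_theta.
by rewrite eq_sym => /eqP.
Qed.

(** * Localizations are combinations of those of the basis *)

(** The vector of localizations of [p] is a Z[X]-combination, with
    coefficients in [J], of those of the l^sigma; the coefficients are common
    to all fixed points. *)
Definition spanned n (J : {poly int} -> Prop) (p : polyA n) : Prop :=
  exists g : 'S_n.+1 -> {poly int}, (forall sigma, J (g sigma)) /\
    forall tau, localize tau p
      = \sum_sigma g sigma * localize tau (lmon sigma).

Definition everything (M : zmodType) (x : M) : Prop := True.

Lemma everything_subgroup M : subgroup (@everything M).
Proof. by []. Qed.

Lemma spanned_subgroup n J : subgroup J -> subgroup (@spanned n J).
Proof.
move=> [J0 JB]; split.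
  exists (fun=> 0); split=> // tau.
  by rewrite raddf0 big1 // => s _; rewrite mul0r.
move=> p q [g [Jg eg]] [h [Jh eh]].
exists (fun s => g s - h s); split=> [s|tau]; first exact: JB.
rewrite (raddfB (localize tau)) /= eg eh -sumrB.
by apply: eq_bigr => s _; rewrite mulrBl.
Qed.

Lemma spanned_mul n (J J' : {poly int} -> Prop) c (p q : polyA n) :
  (forall x, J x -> J' (c * x)) ->
  (forall tau, localize tau q = c * localize tau p) ->
  spanned J p -> spanned J' q.
Proof.
move=> JJ' e [g [Jg eg]].
exists (fun s => c * g s); split=> [s|tau]; first exact: JJ'.
by rewrite e eg mulr_sumr; apply: eq_bigr => s _; rewrite mulrA.
Qed.

Lemma spanned_localize0 n J (p : polyA n) :
  subgroup J -> (forall tau, localize tau p = 0) -> spanned J p.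
Proof.
move=> [J0 _] e; exists (fun=> 0); split=> // tau.
by rewrite e big1 // => s _; rewrite mul0r.
Qed.

Lemma spanned_lmon n (J : {poly int} -> Prop) (sigma : 'S_n.+1) :
  J 0 -> J 1 -> spanned J (lmon sigma).
Proof.
move=> J0 J1; exists (fun s => (s == sigma)%:R).
split=> [s|tau]; first by case: eqP.
rewrite (bigD1 sigma) //= eqxx mul1r big1 ?addr0 // => s /negbTE->.
by rewrite mul0r.
Qed.

Lemma duplicate (T : eqType) (s : seq T) : ~~ uniq s ->
  exists A s', perm_eq s (A :: s') /\ A \in s'.
Proof.
elim: s => //= A s IH; rewrite negb_and negbK.
have [As _|_ /= /IH[B [s' [ps Bs]]]] := boolP (A \in s); first by exists A, s.
exists B, (A :: s'); split; last by rewrite inE Bs orbT.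
rewrite -(perm_cons A) in ps; apply: perm_trans ps _.
exact: permEl (perm_catCA [:: A] [:: B] s').
Qed.

Lemma localize_prod_nested n (tau : 'S_n.+1) (s : seq (properSubset n)) A B :
  A \in s -> B \in s -> ~~ nested A B ->
  localize tau (\prod_(A <- s) l A) = 0.
Proof.
move=> As Bs; apply: contraNeq.
rewrite rmorph_prod /= prodf_seq_neq0 => /allP h.
by apply: (@weight_nested _ tau); rewrite -localize_l; apply: h.
Qed.

(** Induction on the degree, then on the number of repeated factors.  A
    product over a non-chain localizes to 0, and a squarefree chain monomial
    is straightened, its relations being multiples of products of lower
    degree.  If [A] is repeated, let [M] be the product with one factor [l A]
    removed.  Every set that contains [x] and not [y] is [A], or is not a
    factor of [M], and those containing [y] and not [x] are not nested with
    the remaining [A]; so theta_{x,y} [M] is the given product plus products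
    with fewer repetitions, up to products over non-chains. *)
Lemma prod_spanned n (s : seq (properSubset n)) :
  spanned (@everything _) (\prod_(A <- s) l A).
Proof.
have gE := everything_subgroup {poly int}; have gS := @spanned_subgroup n _ gE.
have mulE c p q : (forall tau, localize tau q = c * localize tau p) ->
    @spanned n (@everything _) p -> spanned (@everything _) q.
  exact: spanned_mul.
have [d] := ubnP (size s); elim: d s => // d IHd s sd.
have [e] := ubnP (size s - #|[set A in s]|); elim: e s sd => // e IHe s sd se.
have [cs|] := pselect (chain [set A in s]); last first.
  move=> /existsNP[A /existsNP[B /not_implyP[As /not_implyP[Bs /negP nAB]]]].
  rewrite !inE in As Bs; apply: spanned_localize0 => // tau.
  exact: localize_prod_nested nAB.
have [us|/duplicate[A [s' [ps As']]]] := boolP (uniq s).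
  rewrite -/(chain_monomial s) chain_monomialE //.
  apply: (straightening gS) cs _ => // [sigma|S i j cS Ss ij U].
    exact: spanned_lmon.
  apply: (mulE (linear_form i j) (mon S)) => [tau|].
    exact: localize_block_rel.
  rewrite /mon -big_enum; apply: IHd; rewrite -cardE -ltnS Ss.
  by rewrite cardsE (card_uniqP us).
have eS : [set B in s'] = [set B in s].
  apply/setP => B; rewrite !inE (perm_mem ps) inE.
  by case: eqP => // ->; rewrite As'.
have AS : A \in [set B in s] by rewrite -eS inE.
have ss' : size s = (size s').+1 by rewrite (perm_size ps).
have [x [y J]] := junction_exists [set B in s] A; have [xA yA _ _] := J.
have sxy : sep x y A by rewrite /sep xA.
pose M : polyA n := \prod_(B <- s') l B.
have PM B : B \notin s' -> spanned (@everything _) (l B * M).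
  move=> Bs'; have -> : l B * M = \prod_(C <- B :: s') l C by rewrite big_cons.
  apply: IHe => /=; first by rewrite -ss'.
  rewrite (_ : [set C in B :: s'] = B |: [set C in s']); last first.
    by apply/setP => C; rewrite !inE.
  rewrite cardsU1 inE Bs' eS; move: se; rewrite ss'.
  have : (#|[set B in s]| <= size s')%N by rewrite -eS cardsE card_size.
  by move: #|_| (size s') => u v; lia.
have -> : \prod_(B <- s) l B = theta x y * M
    - (\sum_(B | sep x y B && (B != A)) l B * M - \sum_(B | sep y x B) l B * M).
  rewrite (perm_big _ ps) big_cons -/M /theta sum_mem_sub.
  rewrite [X in (X - _) * _](bigD1 A) //= mulrBl mulrDl -!mulr_suml.
  by rewrite opprB addrA subrK addrK.
apply: gS.2; last apply: gS.2.
- apply: (mulE (linear_form x y) M).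
    by move=> tau; rewrite rmorphM /= localize_theta.
  by apply: IHd; rewrite -ss'.
- apply: subgroup_sum => // B /andP[sB BA].
  apply: PM; apply: contraNN BA => Bs'.
  by rewrite (junction_sep cs AS J _ sB) // -eS inE.
apply: subgroup_sum => // B sB; apply: spanned_localize0 => // tau.
have -> : l B * M = \prod_(C <- B :: s') l C by rewrite big_cons.
apply: (localize_prod_nested _ (A := A) (B := B)).
- by rewrite inE As' orbT.
- by rewrite inE eqxx.
apply/negP => nAB; have := nested_sep nAB sxy.
by rewrite sB.
Qed.

Lemma all_spanned n (p : polyA n) : spanned (@everything _) p.
Proof.
have gS := @spanned_subgroup n _ (everything_subgroup {poly int}).
rewrite [p]mpolyE; apply: big_ind => [|q q'|m _].
- exact: gS.1.
- exact: subgroupD.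
apply: (@spanned_mul _ (@everything _) _ (p@_m)%:P 'X_[m]) => // [tau|].
  exact: localizeZ.
suff [s ->] : exists s : seq (properSubset n), 'X_[m] = \prod_(A <- s) l A.
  exact: prod_spanned.
rewrite mpolyXE_id.
apply: (big_ind (fun q : polyA n => exists s, q = \prod_(A <- s) l A)).
- by exists [::]; rewrite big_nil.
- by move=> _ _ [s ->] [t ->]; exists (s ++ t); rewrite big_cat.
move=> i _; exists (nseq (m i) (enum_val i)).
by rewrite big_nseq /l enum_valK -Monoid.iteropE.
Qed.

(** * Independence *)

Lemma localize_lmon_noninv n (sigma tau : 'S_n.+1) :
  localize tau (lmon sigma) != 0 -> noninv sigma \subset noninv tau.
Proof.
rewrite lmonE rmorph_prod /= => /prodf_neq0 h; apply: ascents_noninv => A As.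
by apply: weight_neq0; rewrite -localize_l; exact: h.
Qed.

Lemma localize_lmon_neq0 n (sigma : 'S_n.+1) : localize sigma (lmon sigma) != 0.
Proof.
rewrite rmorph_prod /=; apply/prodf_neq0 => k kD.
rewrite localize_l weight_initial linear_form_neq0 // (inj_eq perm_inj).
by rewrite -(inj_eq val_inj) /= /bump leq0n; lia.
Qed.

(** Among the sigma with nonzero coefficient, take one with the fewest
    noninversions and localize at it: by triangularity only its own term
    survives. *)
Lemma localize_lmon_free n (g : 'S_n.+1 -> {poly int}) :
  (forall tau, \sum_sigma g sigma * localize tau (lmon sigma) = 0) ->
  forall sigma, g sigma = 0.
Proof.
move=> g0 sigma0; apply/eqP; apply: contraT => nz0.
have [sigma nz smin] :=
  @arg_minnP _ sigma0 [pred s | g s != 0] (fun s => #|noninv s|) nz0.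
have := g0 sigma; rewrite (bigD1 sigma) //= big1 => [|s ns].
  move/eqP; rewrite addr0 mulf_eq0 (negbTE nz) /=.
  by rewrite (negbTE (localize_lmon_neq0 sigma)).
have [->|gs] := eqVneq (g s) 0; first by rewrite mul0r.
have [->|] := eqVneq (localize sigma (lmon s)) 0; first by rewrite mulr0.
move/localize_lmon_noninv => sub.
case/eqP: ns; apply: (@noninv_inj n); apply/eqP.
by rewrite eqEcard sub smin.
Qed.

Definition no_constant_term (g : {poly int}) : Prop := g`_0 = 0.

Lemma no_constant_term_subgroup : subgroup no_constant_term.
Proof.
split; first by rewrite /no_constant_term coef0.
by move=> g h; rewrite /no_constant_term coefB => -> ->.
Qed.

(** R_2 localizes to 0, and a multiple of a generator of R_1 localizes to
    (i - j) X times a spanned vector. *)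
Lemma R12_spanned n (p : polyA n) : p \in R12 n -> spanned no_constant_term p.
Proof.
have gJ := no_constant_term_subgroup; have gS := @spanned_subgroup n _ gJ.
move=> /asboolP[a [b [aR bR ->]]]; apply: subgroupD => //; last first.
  by apply: spanned_localize0 => // tau; exact: localize_R2.
apply: (ideal_gen_sub gS) aR => q _ [i [j [ij ->]]].
apply: (@spanned_mul _ (@everything _) _ (linear_form i j) q) (all_spanned q).
  by move=> x _; rewrite /no_constant_term /linear_form mulrAC coefMX.
by move=> tau; rewrite mulrC rmorphM /= localize_theta.
Qed.

(** By freeness the constants [c sigma] are the coefficients provided by
    [R12_spanned], which vanish at X = 0. *)
Lemma lmon_free_mod_R12 n (c : 'S_n.+1 -> int) :
  \sum_sigma lmon sigma *~ c sigma \in R12 n -> forall sigma, c sigma = 0.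
Proof.
move=> /R12_spanned[g [Jg eg]] sigma.
have /localize_lmon_free/(_ sigma)/eqP : forall tau,
    \sum_s ((c s)%:P - g s) * localize tau (lmon s) = 0.
  move=> tau; under eq_bigr => s _ do rewrite mulrBl.
  rewrite sumrB -eg (raddf_sum (localize tau)).
  apply/eqP; rewrite subr_eq0; apply/eqP.
  apply: eq_bigr => s _; rewrite -scaler_int intz; exact/esym/localizeZ.
rewrite subr_eq0 => /eqP e; have := Jg sigma.
by rewrite /no_constant_term -e coefC.
Qed.

(** * The basis and the relations *)

Lemma straighten_G n (p : polyA n) : p \in G n ->
  exists c : 'S_n.+1 -> int,
    p - \sum_sigma lmon sigma *~ c sigma \in zspan (r_gen n).
Proof.
pose P (p : polyA n) := exists c : 'S_n.+1 -> int,
    p - \sum_sigma lmon sigma *~ c sigma \in zspan (r_gen n).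
have gP : subgroup P.
  split; first by exists (fun=> 0); rewrite big1 ?subrr ?rpred0.
  move=> x y [c cx] [d dy]; exists (fun s => c s - d s).
  under eq_bigr => s _ do rewrite mulrzBr.
  by rewrite sumrB opprD addrACA -opprD rpredB.
apply: (zspan_sub gP) => _ /G_genP[S cS ->].
apply: (straightening gP) cS (erefl _) => [sigma|S' i j cS' _ ij U].
  exists (fun s => (s == sigma)%:R); rewrite (bigD1 sigma) //= eqxx big1.
    by rewrite addr0 subrr rpred0.
  by move=> s /negbTE->.
exists (fun=> 0); rewrite big1 // subr0; apply/zspan_gen/r_genP.
by exists S', i, j.
Qed.

Lemma zspan_r_sub_U n (p : polyA n) : p \in zspan (r_gen n) -> p \in U n.
Proof.
move=> pW; apply/andP; split; move: p pW; apply: zspan_sub;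
  try exact: subgroup_closed; move=> _ /r_genP[S [i [j [cS ij U ->]]]].
  exact: block_rel_R12.
exact: block_rel_G.
Qed.

Lemma homology_class_eq0 n (g : Gmod n) :
  (homology_class g == 0) = (Gval g \in R12 n).
Proof.
have -> : (homology_class g == 0) = (g \in U_in_G n).
  rewrite -[in RHS](subr0 g) (Quotient.idealrBE (U_zmodClosed n)).
  by rewrite -[in LHS](raddf0 (\pi_(Quotient.quot (U_zmodClosed n))%qT)).
by apply/andP/idP => [[]//|gR]; split=> //; exact: Gval_in.
Qed.

Theorem proposition2p2 (n : nat) (hn : (1 <= n)%N) :
  is_Zbasis (fun sigma : 'S_n.+1 => homology_class (l_sigma sigma)) /\
  (forall p : polyA n, (p \in U n) = (p \in zspan (r_gen n))).
Proof.
have classE (c : 'S_n.+1 -> int) :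
    \sum_sigma homology_class (l_sigma sigma) *~ c sigma
    = homology_class (\sum_sigma l_sigma sigma *~ c sigma).
  rewrite /homology_class raddf_sum /=; apply: eq_bigr => s _.
  exact/esym/raddfMz.
have valE (c : 'S_n.+1 -> int) :
    Gval (\sum_sigma l_sigma sigma *~ c sigma)
    = \sum_sigma lmon sigma *~ c sigma.
  rewrite -[LHS]/(val _) (raddf_sum val); apply: eq_bigr => s _.
  exact: (raddfMz val).
split; first split.
- elim/quotW=> g; have [c cx] := straighten_G (Gval_in g).
  exists c; rewrite classE -/(homology_class g).
  apply/eqP; rewrite -subr_eq0.
  rewrite -(raddfB (\pi_(Quotient.quot (U_zmodClosed n))%qT)).
  rewrite -/(homology_class _) homology_class_eq0.
  rewrite -[Gval _]/(val _) (raddfB val) /= valE.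
  by have /zspan_r_sub_U/andP[] := cx.
- move=> c /eqP; rewrite classE homology_class_eq0 valE.
  exact: lmon_free_mod_R12.
move=> p; apply/idP/idP => [/andP[pR pG]|]; last exact: zspan_r_sub_U.
have [c cp] := straighten_G pG; have /andP[dR _] := zspan_r_sub_U cp.
have c0 : forall sigma, c sigma = 0.
  apply: lmon_free_mod_R12; rewrite -[X in X \in _](subKr p); exact: rpredB.
by move: cp; rewrite big1 ?subr0 // => s _; rewrite c0.
Qed.
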